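(* Let $n\ge 3$, let $H\subseteq\mathbb{C}^n$ be an additive subgroup with $\operatorname{span}_{\mathbb{C}}H=\mathbb{C}^n$, and let $0\neq t\in H$. Then the central simple $n$-Lie algebra $P(H,t)$ is not isomorphic (as an $n$-Lie algebra) to any simple nonabelian $n$-Lie algebra of one of the following three forms: (i) $S(A,\mathfrak g)$, on the full underlying space $A$; (ii) $W(A,\mathfrak g)$, on the full underlying space $A$; (iii) $SW(A,D)$, on the full underlying space $A^{\oplus(n-1)}$. Here in (i) and (ii) $A$ is any commutative associative complex algebra and $\mathfrak g\subseteq\operatorname{Der}A$ is any Lie algebra of dimension $n$ in (i), respectively $n-1$ in (ii), such that $A$ is $\mathfrak g$-simple, and in (iii) $A$ is any commutative associative complex algebra with a derivation $D$ such that $A$ has no nonzero proper $D$-invariant ideal.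
   Context: All vector spaces are over $\mathbb{C}$. An $n$-Lie algebra is a vector space $L$ with an alternating $n$-linear bracket satisfying $[x_1,\ldots,x_{n-1},[y_1,\ldots,y_n]]=\sum_{i=1}^n[y_1,\ldots,[x_1,\ldots,x_{n-1},y_i],\ldots,y_n]$. An ideal is a subspace $I$ with $[I,L,\ldots,L]\subseteq I$; $L$ is simple if $[L,\ldots,L]\neq0$ and its only ideals are $0$ and $L$. Its centroid consists of all linear $T:L\to L$ with $T([x_1,\ldots,x_n])=[x_1,\ldots,T(x_i),\ldots,x_n]$ for all $i$ and all $x_1,\ldots,x_n$; a simple $L$ is central simple if its centroid is $\mathbb{C}\,\mathrm{id}_L$. ''Nonabelian'' means the bracket is not identically zero. $P(H,t)$: put $\Lambda=H\setminus\{0,t\}$. $P(H,t)$ has basis $\{u_a:a\in\Lambda\}$ and bracket $[u_{a_1},\ldots,u_{a_n}]=\det(a_1,\ldots,a_n)\,u_{a_1+\cdots+a_n+t}$, where $u_0=u_t=0$. (Equivalently, it is the quotient of the $n$-Lie algebra $\bigoplus_{a\in H\setminus\{t\}}\mathbb{C}e_a$ with bracket $[e_{a_1},\ldots,e_{a_n}]=\det(a_1,\ldots,a_n)e_{a_1+\cdots+a_n+t}$ by its central ideal $\mathbb{C}e_0$.) It is known (Pozhidaev) that $P(H,t)$ is a central simple $n$-Lie algebra. Let $A$ be a commutative associative complex algebra, not necessarily unital, and $\mathfrak g\subseteq\operatorname{Der}A$ a Lie algebra. $A$ is $\mathfrak g$-simple if it has no nonzero proper associative ideal invariant under every element of $\mathfrak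 g$. $S(A,\mathfrak g)$: if $\dim\mathfrak g=n$ with basis $D_1,\ldots,D_n$, this is the space $A$ with bracket $[f_1,\ldots,f_n]_S=\det\bigl(D_i(f_j)\bigr)_{1\le i,j\le n}$. $W(A,\mathfrak g)$: if $\dim\mathfrak g=n-1$ with basis $D_1,\ldots,D_{n-1}$, this is the space $A$ with bracket $[f_1,\ldots,f_n]_W$ equal to the determinant of the $n\times n$ matrix whose first row is $(f_1,\ldots,f_n)$ and whose $(i+1)$-st row is $(D_i(f_1),\ldots,D_i(f_n))$, $1\le i\le n-1$. $SW(A,D)$: for a derivation $D$ of $A$ such that $A$ has no nonzero proper $D$-invariant ideals, this is the space $A^{\langle1\rangle}\oplus\cdots\oplus A^{\langle n-1\rangle}$, where $A^{\langle j\rangle}$ is a copy of $A$ and $f^{\langle j\rangle}$ is the copy of $f\in A$ (of ''color'' $j$). A bracket of $n$ homogeneous elements is zero unless every color $1,\ldots,n-1$ occurs; if color $k$ is the repeated one, then $$[f_1^{\langle1\rangle},\ldots,f_{k-1}^{\langle k-1\rangle},f_k^{\langle k\rangle},f_{k+1}^{\langle k\rangle},f_{k+2}^{\langle k+1\rangle},\ldots,f_n^{\langle n-1\rangle}]=(-1)^{k+n-1}\bigl(f_1\cdots f_{k-1}(D(f_k)f_{k+1}-f_kD(f_{k+1}))f_{k+2}\cdots f_n\bigr)^{\langle k\rangle},$$ extended by alternating multilinearity. *)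

(* Defs.v *)
From HB Require Import structures.
From mathcomp Require Import all_boot all_order all_fingroup all_algebra.
From mathcomp Require Import finmap monalg complex.
From mathcomp Require Import boolp classical_sets cardinality fsbigop reals.

Set Implicit Arguments.
Unset Strict Implicit.
Unset Printing Implicit Defensive.

Import GRing.Theory.

Local Open Scope classical_set_scope.
Local Open Scope ring_scope.

(* [insert p z x] is the (m+1)-tuple with z at position p and the entries of
   the m-tuple x, in order, at the other positions; [replace x i z] is x with
   its i-th entry changed to z. *)
Definition insert (T : Type) (m : nat) (p : 'I_m.+1) (z : T) (x : 'I_m -> T) :
    'I_m.+1 -> T :=
  fun q => if unlift p q is Some i then x i else z.

Definition replace (T : Type) (n : nat) (x : 'I_n -> T) (i : 'I_n) (z : T) :
    'I_n -> T :=
  fun j => if j == i then z else x j.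

Section NLie.
Variable K : fieldType.

Definition subspace (V : lmodType K) (I : set V) : Prop :=
  [/\ I 0, forall x y, I x -> I y -> I (x + y) & forall (c : K) x, I x -> I (c *: x)].

Section Bracket.
Variables (n : nat) (L : lmodType K).
Implicit Type br : ('I_n -> L) -> L.

Definition multilinear br : Prop :=
  forall (i : 'I_n) (x : 'I_n -> L) (c : K) (y z : L),
    br (replace x i (c *: y + z)) = c *: br (replace x i y) + br (replace x i z).

Definition alternating br : Prop :=
  forall (x : 'I_n -> L) (i j : 'I_n), i != j -> x i = x j -> br x = 0.

Definition nonabelian br : Prop := exists x, br x <> 0.
End Bracket.

(* The arity is n = m+1 throughout. *)
Section NLieAlgebra.
Variables (m : nat) (L : lmodType K).
Implicit Type br : ('I_m.+1 -> L) -> L.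

Definition filippov br : Prop :=
  forall (x : 'I_m -> L) (y : 'I_m.+1 -> L),
    br (insert ord_max (br y) x)
    = \sum_(i < m.+1) br (replace y i (br (insert ord_max (y i) x))).

Definition nLie br : Prop := [/\ multilinear br, alternating br & filippov br].

Definition nLie_ideal br (I : set L) : Prop :=
  subspace I /\ forall x : 'I_m.+1 -> L, I (x ord0) -> I (br x).

(* [L, ..., L] is the span of the values of the bracket, so that it is nonzero
   iff some bracket is. *)
Definition nLie_simple br : Prop :=
  (exists x, br x <> 0) /\
  forall I : set L, nLie_ideal br I -> I = [set 0] \/ I = setT.

Definition simple_nonabelian_nLie br : Prop :=
  [/\ nLie br, nLie_simple br & nonabelian br].
End NLieAlgebra.

Definition nLie_isomorphic (n : nat) (L1 L2 : lmodType K)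
    (br1 : ('I_n -> L1) -> L1) (br2 : ('I_n -> L2) -> L2) : Prop :=
  exists2 phi : {linear L1 -> L2}, bijective phi &
    forall x : 'I_n -> L1, phi (br1 x) = br2 (fun i => phi (x i)).

Section P.
Variable n : nat.

Definition spans (H : {pred 'rV[K]_n}) : Prop :=
  forall v : 'rV[K]_n, exists2 X : seq 'rV[K]_n, {subset X <= H} & v \in <<X>>%VS.

Variables (H : {pred 'rV[K]_n}) (t : 'rV[K]_n).

Definition P_index : choiceType :=
  {a : 'rV[K]_n | [&& a \in H, a != 0 & a != t]}.

(* {malg K[X]} is used only as the free K-module on the set X; no monoid
   structure on X is involved. *)
Definition P_space : lmodType K := {malg K[P_index]}.

(* In particular P_u 0 = P_u t = 0. *)
Definition P_u (v : 'rV[K]_n) : P_space :=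
  if insub v is Some a then << (a : P_index) >> else 0.

(* Multilinear extension of
   (u_(a_1), ..., u_(a_n)) |-> det (a_1, ..., a_n) u_(a_1 + ... + a_n + t);
   the sum over all n-tuples of indices has finite support. *)
Definition P_bracket (x : 'I_n -> P_space) : P_space :=
  \sum_(a \in [set: {ffun 'I_n -> P_index}])
    ((\prod_i (x i)@_(a i)) * \det (\matrix_i val (a i)))
      *: P_u (\sum_i val (a i) + t).

Lemma P_bracket_finite (x : 'I_n -> P_space) :
  finite_set [set a : {ffun 'I_n -> P_index} | \prod_i (x i)@_(a i) != 0].
Proof.
pose E := (\bigcup_(i in [set: 'I_n]) [set` msupp (x i)])%classic.
have finE : finite_set E by apply: bigcup_finite.
have /finite_fsetP[X EX] := finE.
pose h (b : {ffun 'I_n -> X}) : {ffun 'I_n -> P_index} := [ffun i => val (b i)].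
apply: (@sub_finite_set _ _ (h @` setT)); last exact: finite_image.
move=> a /= /prodf_neq0 na.
have aX i : a i \in X.
  have : E (a i) by exists i => //=; rewrite -mcoeff_neq0; apply: na.
  by rewrite EX.
by exists [ffun i => [` aX i]%fset] => //; apply/ffunP => i; rewrite !ffunE.
Qed.

Lemma P_bracket_multilinear : multilinear P_bracket.
Proof.
move=> i x c y z.
pose supp (w : 'I_n -> P_space) := [set a : {ffun 'I_n -> P_index} | \prod_j (w j)@_(a j) != 0].
pose S := supp (replace x i (c *: y + z)) `|`
          (supp (replace x i y) `|` supp (replace x i z)).
have finS : finite_set S by rewrite !finite_setU; split; [|split]; apply: P_bracket_finite.
have PE w : supp w `<=` S -> P_bracket w = \sum_(a <- fset_set S)
    ((\prod_j (w j)@_(a j)) * \det (\matrix_j val (a j)))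
      *: P_u (\sum_j val (a j) + t).
  move=> wS; rewrite /P_bracket -(fsbig_widen S setT) //; first by rewrite fsbig_finite.
  move=> a [_ nSa] /=; have /negP/negPn/eqP-> : ~ supp w a by move=> /wS.
  by rewrite mul0r scale0r.
rewrite !PE; first 1 last.
- by move=> a ?; right; right.
- by move=> a ?; right; left.
- by move=> a ?; left.
rewrite scaler_sumr -big_split /=; apply: eq_bigr => a _.
rewrite scalerA -scalerDl mulrA -mulrDl; congr ((_ * _) *: _).
rewrite !(bigD1 (P := xpredT) i) //= /replace !eqxx mcoeffD mcoeffZ mulrDl mulrA.
by congr (_ * _ + _ * _); apply: eq_bigr => j /negbTE->.
Qed.

Lemma P_bracket_basis (a : 'I_n -> P_index) :
  P_bracket (fun i => P_u (val (a i)))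
  = \det (\matrix_i val (a i)) *: P_u (\sum_i val (a i) + t).
Proof.
rewrite /P_bracket -(fsbig_widen [set [ffun i => a i]] setT) //; last first.
  move=> b [_ nb]; have [i bi] : exists i, b i != a i.
    apply/existsP; rewrite -negb_forall; apply/negP => /forallP e.
    by apply: nb; apply/ffunP => i; rewrite ffunE; apply/eqP.
  rewrite /= (bigD1 i) //= /P_u valK mcoeffU eq_sym (negbTE bi) !mul0r.
  by rewrite scale0r.
rewrite fsbig_set1 big1 ?mul1r; last first.
  by move=> i _; rewrite ffunE /P_u valK mcoeffU eqxx.
congr (\det _ *: P_u (_ + t)).
  by apply/matrixP => i j; rewrite !mxE ffunE.
by apply: eq_bigr => i _; rewrite ffunE.
Qed.
End P.

(* Commutative associative algebras, possibly without unit. *)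
Record comAlgebra := ComAlgebra {
  ca_sort :> lmodType K;
  ca_mul : ca_sort -> ca_sort -> ca_sort;
  ca_mulA : associative ca_mul;
  ca_mulC : commutative ca_mul;
  ca_mulDl : left_distributive ca_mul +%R;
  ca_scalerAl : forall (c : K) (f g : ca_sort),
    c *: ca_mul f g = ca_mul (c *: f) g
}.

Section ComAlgebra.
Variable A : comAlgebra.
Local Notation "f ** g" := (ca_mul f g) (at level 40, left associativity).

Definition derivation (D : A -> A) : Prop :=
  (forall (c : K) f g, D (c *: f + g) = c *: D f + D g) /\
  (forall f g, D (f ** g) = D f ** g + f ** D g).

Definition lie_subalgebra_Der (g : set (A -> A)) : Prop :=
  [/\ forall D, g D -> derivation D,
      g (fun=> 0),
      forall (c : K) D E, g D -> g E -> g (fun f => c *: D f + E f) &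
      forall D E, g D -> g E -> g (fun f => D (E f) - E (D f))].

Definition basis_Der (k : nat) (g : set (A -> A)) (D : 'I_k -> A -> A) : Prop :=
  [/\ forall i, g (D i),
      forall E, g E -> exists c : 'I_k -> K, forall f, E f = \sum_i c i *: D i f &
      forall c : 'I_k -> K,
        (forall f, \sum_i c i *: D i f = 0) -> forall i, c i = 0].

Definition assoc_ideal (I : set A) : Prop :=
  subspace I /\ forall f g, I f -> I (f ** g).

Definition g_simple (g : set (A -> A)) : Prop :=
  forall I : set A, assoc_ideal I -> (forall D f, g D -> I f -> I (D f)) ->
    I = [set 0] \/ I = setT.

(* As A need not have a unit, the product of the empty family is a junk value;
   it is only used for nonempty families. *)
Definition fam_prod (k : nat) (f : 'I_k -> A) : A :=
  if [seq f i | i <- enum 'I_k] is f0 :: s then foldl (@ca_mul A) f0 s else 0.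

Definition alg_det (k : nat) (M : 'I_k -> 'I_k -> A) : A :=
  \sum_(s : 'S_k) (-1) ^+ s *: fam_prod (fun i => M i (s i)).

Definition S_bracket (n : nat) (D : 'I_n -> A -> A) (f : 'I_n -> A) : A :=
  alg_det (fun i j => D i (f j)).

Definition W_bracket (m : nat) (D : 'I_m -> A -> A) (f : 'I_m.+1 -> A) : A :=
  alg_det (fun i j => insert ord0 (f j) (fun k => D k (f j)) i).

Section SW.
Variables (m : nat) (D : A -> A).

(* A^<1> + ... + A^<m>; colors are numbered from 0. *)
Definition SW_space : lmodType K := {ffun 'I_m -> A}.

Definition colored (k : 'I_m) (f : A) : SW_space :=
  [ffun j => if j == k then f else 0].

(* In the last clause f i has color i and h is a second element of color k,
   placed right after f k.  In 1-based numbering the color is k+1 and n = m+1,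
   so that the exponent of -1 is (k+1) + n - 1 = k + m + 1. *)
Definition is_SW_bracket (br : ('I_m.+1 -> SW_space) -> SW_space) : Prop :=
  [/\ multilinear br, alternating br,
      forall (c : 'I_m.+1 -> 'I_m) (f : 'I_m.+1 -> A),
        (exists k, forall p, c p != k) -> br (fun p => colored (c p) (f p)) = 0 &
      forall (k : 'I_m) (f : 'I_m -> A) (h : A),
        br (insert (lift ord0 k) (colored k h) (fun i => colored i (f i)))
        = (-1) ^+ (k + m).+1 *:
          colored k (fam_prod (fun i =>
            if i == k then D (f k) ** h - f k ** D h else f i))].
End SW.

End ComAlgebra.
End NLie.

(* Main.v *)
(* Let [f_a] be the image of [u_a] under an isomorphism onto an algebra of one
   of the three forms. Its bracket, or each component of it, is a determinant
   [det (E_p x_q)] over [A], where the row maps [E_p] are derivations,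
   projections onto a copy of [A], or a projection followed by [D]; thus
   [det (E_p f_(c_q)) = det (c) f_(c_1 + ... + c_n + t)]. For a basis [c] in [H]
   with [c_1 + ... + c_n = - t], Cramer's rule applied to [c_i + c_j] gives
   [f_(c_j) E_p f_(c_i) + f_(c_i) E_p f_(c_j) = 0], because [f_0 = 0]. Hence, for
   independent [a], [b], [t]:
   - if a projection is among the rows (W and SW), [f_a f_b = 0];
   - in S, [f_a f_b] is killed by all the derivations, so it is central, so it
     vanishes by simplicity.
   Multiplying by the determinants that express the other [f_b] propagates this
   to all products (W, SW) or all triple products (S) of elements of [A]. As
   [n >= 3], the bracket vanishes. *)

From HB Require Import structures.
Require Import Defs.
From mathcomp Require Import all_boot all_order all_fingroup all_algebra zify.
From mathcomp Require Import finmap monalg complex.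
From mathcomp Require Import boolp classical_sets reals.

Set Implicit Arguments.
Unset Strict Implicit.
Unset Printing Implicit Defensive.

Import GRing.Theory Num.Theory.

Local Open Scope classical_set_scope.
Local Open Scope ring_scope.

(** * Determinant identities over a commutative ring *)

Section Determinant.
Variables (R : comPzRingType) (n : nat).
Implicit Types M N : 'M[R]_n.

(** The two matrices have the same cofactors along column [i]. *)
Lemma det_eqM_col M N i x y :
  (forall p, x * M p i = y * N p i) ->
  (forall p q, q != i -> M p q = N p q) -> x * \det M = y * \det N.
Proof.
move=> Ei Enoti; rewrite !(expand_det_col _ i) !mulr_sumr.
apply: eq_bigr => p _; rewrite !mulrA Ei; congr (_ * _); congr (\det _).
by apply/matrixP => k l; rewrite !mxE Enoti // eq_sym neq_lift.
Qed.

Lemma det_mulr0_row M i x : (forall q, x * M i q = 0) -> x * \det M = 0.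
Proof.
move=> Mi0; rewrite (expand_det_row _ i) mulr_sumr big1 // => q _.
by rewrite mulrA Mi0 mul0r.
Qed.

Lemma det_mulr0_col M i x : (forall p, x * M p i = 0) -> x * \det M = 0.
Proof.
move=> Mi0; rewrite (expand_det_col _ i) mulr_sumr big1 // => q _.
by rewrite mulrA Mi0 mul0r.
Qed.

(** Apply [M *m \adj M = (\det M)%:M] to the column [u]: the entries of [\adj M *m u] are the
    determinants with one column replaced by [u]. Nothing is divided by [\det M], which may be a
    zero divisor. *)
Lemma cramer_expansion M (u : 'I_n -> R) r :
  \det M * u r =
  \sum_i \det (\matrix_(p, q) (if q == i then u p else M p q)) * M r i.
Proof.
have := congr1 (fun N => (N *m \col_p u p) r 0) (mul_mx_adj M).
rewrite -mulmxA mul_scalar_mx [LHS]mxE [RHS]mxE [X in _ * X]mxE => <-.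
apply: eq_bigr => i _; rewrite mulrC; congr (_ * _).
rewrite (expand_det_col _ i) mxE; apply: eq_bigr => p _.
rewrite !mxE eqxx mulrC /cofactor; congr (_ * (_ * \det _)).
by apply/matrixP => k l; rewrite !mxE eq_sym (negbTE (neq_lift _ _)).
Qed.

(* Two rows supported in one and the same column are proportional. *)
Lemma det0_rows M i j q0 : i != j ->
  (forall q, q != q0 -> M i q = 0) -> (forall q, q != q0 -> M j q = 0) ->
  \det M = 0.
Proof.
move=> ij Mi Mj; rewrite /determinant big1 // => s _.
case: (eqVneq (s i) q0) => [siq0|siq0].
  rewrite (bigD1 j) //= Mj ?mul0r ?mulr0 // -siq0.
  by rewrite (inj_eq perm_inj) eq_sym.
by rewrite (bigD1 i) //= Mi // mul0r mulr0.
Qed.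

End Determinant.

Lemma det_colD (R : comPzRingType) n (M N P : 'M[R]_n) i :
  (forall p, M p i = N p i + P p i) ->
  (forall p q, q != i -> N p q = M p q) -> (forall p q, q != i -> P p q = M p q) ->
  \det M = \det N + \det P.
Proof.
move=> Ei N_M P_M; rewrite -det_tr -(det_tr N) -(det_tr P).
rewrite (determinant_multilinear (A := M^T) (B := N^T) (C := P^T) (i0 := i)
  (b := 1) (c := 1)) ?mul1r //.
- by rewrite !scale1r; apply/rowP => p; rewrite !mxE.
- by apply/matrixP => p q; rewrite !mxE N_M // eq_sym neq_lift.
- by apply/matrixP => p q; rewrite !mxE P_M // eq_sym neq_lift.
Qed.

(** Row [P] has at most two nonzero entries, in the adjacent columns [P] and [lift P k], and both
    minors in the expansion along it are diagonal. *)
Lemma det_bordered_diag (R : comPzRingType) m (k : 'I_m) (M : 'M[R]_m.+1)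
    (f : 'I_m -> R) (h : R) (P := lift ord0 k) :
  (forall l, l != k -> M P (lift P l) = 0) ->
  (forall i, M (lift P i) P = if i == k then h else 0) ->
  (forall i l, M (lift P i) (lift P l) = if i == l then f i else 0) ->
  \det M = (f k * M P P - h * M P (lift P k)) * \prod_(i | i != k) f i.
Proof.
move=> rowP colP diagM.
(* Since [P] is position [k + 1], [lift P k] is position [k]. Deleting that column instead of [P]
   only puts column [P] in the place of colour [k]. *)
have lift_k l : lift (lift P k) l = if l == k then P else lift P l.
  case: eqVneq => [->|lk]; apply: val_inj; rewrite /= /bump; first by lia.
  by have : val l != val k by []; move=> /=; lia.
have det_diagE (g : 'I_m -> R) (N : 'M[R]_m) :
    (forall i l, N i l = if i == l then g i else 0) -> \det N = \prod_i g i.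
  move=> NE; rewrite (_ : N = diag_mx (\row_i g i)).
    by rewrite det_diag; apply: eq_bigr => i _; rewrite mxE.
  apply/matrixP => i l; rewrite NE !mxE.
  by case: eqVneq => [->|]; rewrite ?mulr1n ?mulr0n.
rewrite (expand_det_row _ P) (bigD1 P) //= (bigD1 (lift P k)) /=; last first.
  by rewrite eq_sym neq_lift.
rewrite big1 => [|q /andP[]]; last first.
  case: (unliftP P q) => [i ->|->]; last by rewrite eqxx.
  by rewrite (inj_eq lift_inj) => _ ik; rewrite rowP // mul0r.
rewrite addr0 /cofactor (det_diagE f); last first.
  by move=> i l; rewrite !mxE diagM.
rewrite (det_diagE (fun i => if i == k then h else f i)); last first.
  move=> i l; rewrite !mxE lift_k.
  have [->|lk] := eqVneq l k; first by rewrite colP; case: (i == k).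
  by rewrite diagM; case: eqVneq => // ->; rewrite (negbTE lk).
rewrite (bigD1 k) //= [X in _ + _ * (_ * X)](bigD1 k) //= eqxx.
rewrite [X in _ + _ * (_ * (_ * X))](eq_bigr f) => [|i /negbTE->] //.
rewrite addnn -signr_odd odd_double expr0 mul1r.
(* The second entry is just off the diagonal, so its cofactor has sign -1. *)
have -> : (bump 0 k + bump (bump 0 k) k)%N = (k + k).+1.
  by rewrite /bump leq0n add1n ltnn.
rewrite exprS addnn -signr_odd odd_double mulr1.
by rewrite mulN1r mulrN mulrBl !mulrA [f k * _]mulrC [h * _]mulrC.
Qed.

(** * Bases of the space consisting of elements of a spanning subgroup *)

Section Basis.
Variables (K : numFieldType) (m : nat).
Local Notation n := m.+1.
Implicit Types (c : 'I_n -> 'rV[K]_n) (G : {pred 'rV[K]_n}).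

Definition rows c : 'M[K]_n := \matrix_i c i.

Lemma det_rows_eq0 c (k : 'I_n -> K) :
  \det (rows c) != 0 -> \sum_i k i *: c i = 0 -> forall i, k i = 0.
Proof.
rewrite -unitfE -unitmxE => cU kc0.
suff k0 : \row_i k i = 0 by move=> i; have := congr1 (fun v : 'rV_n => v 0 i) k0; rewrite !mxE.
have : \row_i k i *m rows c = 0.
  rewrite -[RHS]kc0 mulmx_sum_row; apply: eq_bigr => i _.
  by rewrite mxE rowK.
by move/(congr1 (mulmx^~ (invmx (rows c)))); rewrite mulmxK // mul0mx.
Qed.

Lemma det_rows_neq0 c :
  (fullv <= <<[seq c i | i <- enum 'I_n]>>)%VS -> \det (rows c) != 0.
Proof.
move=> full; rewrite -unitfE -unitmxE -row_full_unit -sub1mx.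
apply/row_subP => i; move: (row i _) => v.
have {full} : v \in <<[seq c i | i <- enum 'I_n]>>%VS.
  by apply: (subvP full); rewrite memvf.
elim: (enum 'I_n) v => [|j s IHs] v /=.
  by rewrite span_nil memv0 => /eqP->; rewrite sub0mx.
rewrite span_cons => /memv_addP[_ /vlineP[k ->] [w ws ->]].
rewrite addmx_sub //; last exact: IHs.
by rewrite scalemx_sub // -(rowK c j) row_sub.
Qed.

Lemma spans_notin G (U : {vspace 'rV[K]_n}) : spans G -> ~~ (fullv <= U)%VS ->
  exists2 z, z \in G & z \notin U.
Proof.
move=> spG /subvPn[v _ vU]; have [Z ZG vZ] := spG v.
have [z zZ zU] : exists2 z, z \in Z & z \notin U.
  apply/hasP; apply: contraR vU; rewrite -all_predC => /allP ZU.
  apply: (subvP _ _ vZ); apply/span_subvP => z zZ.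
  by have /negPn := ZU _ zZ.
by exists z; first exact: ZG.
Qed.

Lemma free_extend G (X : seq 'rV[K]_n) : spans G -> free X ->
  exists2 Y, {subset Y <= G} & basis_of fullv (X ++ Y).
Proof.
move=> spG; have [k] := ubnP (n - size X).
elim: k X => // k IHk X ltk frX.
have [full|nfull] := boolP (fullv <= <<X>>)%VS.
  by exists [::]; rewrite // cats0 basisEfree frX subvf -(eqP frX) dimvS.
have [z zG zX] := spans_notin spG nfull.
have frzX : free (rcons X z).
  have /perm_free-> : perm_eq (rcons X z) (z :: X) by rewrite perm_rcons.
  by rewrite free_cons zX frX.
have szX : (size (rcons X z) <= n)%N.
  rewrite -(eqP frzX) (leq_trans (dimvS (subvf _))) // dimvf /dim /=.
  by rewrite mul1n.
have [||Y YG bY] := IHk (rcons X z) => //.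
  by move: ltk szX; rewrite size_rcons; lia.
exists (z :: Y); last by rewrite -cat_rcons.
by move=> y; rewrite inE => /predU1P[->|/YG//].
Qed.

Lemma map_nth_enum_ord (C : seq 'rV[K]_n) : size C = n ->
  [seq nth 0 C i | i : 'I_n <- enum 'I_n] = C.
Proof.
move=> szC; rewrite -[RHS](mkseq_nth 0) /mkseq szC -val_enum_ord -map_comp.
exact: eq_map.
Qed.

Lemma sum_nth_ord (C : seq 'rV[K]_n) : size C = n ->
  \sum_(i < n) nth 0 C i = \sum_(v <- C) v.
Proof.
by move=> szC; rewrite -[in RHS](map_nth_enum_ord szC) big_map big_enum.
Qed.

(** Fix [e] in [H] outside [U]. A vector [h] of [H] lying in [U] is recovered from [h + e] and [e],
    both outside [U]. *)
Lemma spans_diff (H : zmodClosed 'rV[K]_n) (U : {vspace 'rV[K]_n}) :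
  spans H -> ~~ (fullv <= U)%VS -> spans [pred h in H | h \notin U].
Proof.
move=> spH nfull v; have [e eH eU] := spans_notin spH nfull.
have [X XH vX] := spH v.
pose X' := e :: [seq if h \in U then h + e else h | h <- X].
exists X'.
  move=> h; rewrite !inE => /predU1P[->|/mapP[x /XH xH ->]]; first by rewrite eH.
  by case: ifPn => xU; rewrite ?xH ?xU // rpredD //= addrC rpredDr.
apply: subvP vX; apply/span_subvP => x xX.
have eX' : e \in <<X'>>%VS by rewrite memv_span ?mem_head.
have : (if x \in U then x + e else x) \in <<X'>>%VS.
  by rewrite memv_span // inE (map_f (fun h => if h \in U then h + e else h)) ?orbT.
by case: ifP => // _; rewrite rpredDr.
Qed.

(* Extend [q] by vectors outside [U] and subtract them from [q]; if the
   difference falls into [U], doubling one of the vectors moves it out. *)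
Lemma exists_basis_sum (H : zmodClosed 'rV[K]_n) (U : {vspace 'rV[K]_n}) q :
  (0 < m)%N -> spans H -> ~~ (fullv <= U)%VS -> q \in H -> q != 0 ->
  exists c : 'I_n -> 'rV[K]_n,
    [/\ forall i, c i \in H, forall i, c i \notin U, \sum_i c i = q
      & \det (rows c) != 0].
Proof.
move=> m0 spH nfull qH q0.
have [|Y YG bY] := @free_extend _ [:: q] (spans_diff spH nfull).
  by rewrite free_cons span_nil memv0 q0 nil_free.
have szY : size Y = m.
  have := size_basis (X := in_tuple ([:: q] ++ Y)) bY.
  by rewrite dimvf /dim /= mul1n => -[].
case: Y => [|y Y] in YG bY szY; first by rewrite -[m]szY in m0.
have [yH yU] : y \in H /\ y \notin U.
  by apply/andP; have := YG y (mem_head _ _); rewrite inE.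
pose z (r : nat) := q - (y *+ r + \sum_(v <- Y) v).
have [r r0 zU] : exists2 r, (0 < r)%N & z r \notin U.
  have [z1U|z1U] := boolP (z 1 \in U); last by exists 1.
  exists 2 => //; apply: contra yU => z2U.
  suff <- : z 1 - z 2 = y by rewrite rpredB.
  by rewrite /z opprB addrC subrKA opprD addrACA subrr addr0 mulr2n addrK.
pose C := z r :: y *+ r :: Y.
have szC : size C = n by congr S.
have sumC : \sum_(v <- C) v = q by rewrite !big_cons /= subrK.
have CG : forall v, v \in C -> (v \in H) && (v \notin U).
  have YG' v : v \in Y -> (v \in H) && (v \notin U).
    by move=> vY; have := YG v; rewrite !inE vY orbT => ->.
  move=> v; rewrite !inE => /or3P[/eqP->|/eqP->|/YG'//].
    rewrite zU rpredB // rpredD ?rpredMn // big_seq rpred_sum // => x.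
    by move=> /YG'/andP[].
  by rewrite rpredMn //= -scaler_nat rpredZeq pnatr_eq0 eqn0Ngt r0.
exists (fun i => nth 0 C i); split.
- by move=> i; have /CG/andP[] : C`_i \in C by rewrite mem_nth // szC.
- by move=> i; have /CG/andP[] : C`_i \in C by rewrite mem_nth // szC.
- by rewrite sum_nth_ord.
(* [C] spans: [q] is the sum of its members, and [y] is a multiple of [y *+ r] in characteristic
   0. *)
apply: det_rows_neq0; rewrite map_nth_enum_ord // -(span_basis bY).
apply/span_subvP => v; rewrite !inE => /or3P[/eqP->|/eqP->|vY].
- by rewrite -sumC big_seq rpred_sum // => x xC; rewrite memv_span.
- have yr : y *+ r \in <<C>>%VS by rewrite memv_span // !inE eqxx orbT.
  by move: yr; rewrite -scaler_nat rpredZeq pnatr_eq0 eqn0Ngt r0.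
- by rewrite memv_span // !inE vY !orbT.
Qed.

End Basis.

(** * Consequences of the bracket relations written as determinants *)

Section JacobianSystem.
Variables (K : numFieldType) (m : nat) (m_gt1 : (1 < m)%N).
Local Notation n := m.+1.
Variables (H : zmodClosed 'rV[K]_n) (spH : spans H).
Variables (t : 'rV[K]_n) (tH : t \in H) (t_neq0 : t != 0).
Implicit Types (a b v x y z : 'rV[K]_n) (c : 'I_n -> 'rV[K]_n).

Definition idx v := [&& v \in H, v != 0 & v != t].

Section System.
Variable B : comAlgType K.

(** The trace of an isomorphism in one component of the target: [f v] stands for the image of [u_v],
    and [E p v] for its image under the [p]-th row map. The first clause reflects [u_0 = 0]. *)
Definition jacobian_system (f : 'rV[K]_n -> B) (E : 'I_n -> 'rV[K]_n -> B) :=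
  f 0 = 0 /\ forall c, (forall i, idx (c i)) ->
    \det (\matrix_(p, q) E p (c q)) = \det (rows c) *: f (\sum_i c i + t).

Lemma sum_delta c i : \sum_l (l == i)%:R *: c l = c i.
Proof.
by rewrite (bigD1 i) //= eqxx scale1r big1 ?addr0 // => l /negbTE->; rewrite scale0r.
Qed.

Lemma det_rows_replaceD c i x y :
  \det (rows (replace c i (x + y))) =
  \det (rows (replace c i x)) + \det (rows (replace c i y)).
Proof.
rewrite (determinant_multilinear (i0 := i) (B := rows (replace c i x))
  (C := rows (replace c i y)) (b := 1) (c := 1)) ?mul1r //.
- by rewrite !scale1r; apply/rowP => q; rewrite !mxE /replace eqxx mxE.
- by apply/matrixP => p q; rewrite !mxE /replace eq_sym (negbTE (neq_lift _ _)).
- by apply/matrixP => p q; rewrite !mxE /replace eq_sym (negbTE (neq_lift _ _)).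
Qed.

Lemma det_rows_replace c i j :
  \det (rows (replace c i (c j))) = \det (rows c) *+ (i == j).
Proof.
case: eqVneq => [->|ij].
  congr (\det _); apply/matrixP => p q; rewrite !mxE /replace.
  by case: eqVneq => // ->.
apply: (determinant_alternate ij) => q.
by rewrite !mxE /replace eqxx eq_sym (negbTE ij).
Qed.

Lemma sum_replace c i v : \sum_l replace c i v l = \sum_l c l - c i + v.
Proof.
rewrite (bigD1 i) //= /replace eqxx [in RHS](bigD1 i) //= [c i + _]addrC addrK addrC.
by congr (_ + _); apply: eq_bigr => l /negbTE->.
Qed.

Lemma idx_replace c i v :
  (forall l, idx (c l)) -> idx v -> forall l, idx (replace c i v l).
Proof. by move=> ci iv l; rewrite /replace; case: ifP. Qed.

Variables (f : 'rV[K]_n -> B) (E : 'I_n -> 'rV[K]_n -> B).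
Hypothesis fE : jacobian_system f E.

(* With [v = c i + c j] the Cramer expansion of [v] along the basis [c] has
   only two nonzero terms, and its left-hand side is a multiple of [f 0]. *)
Lemma anti_basis c i j r : i != j -> (forall l, c l \in H) ->
  \sum_l c l = - t -> \det (rows c) != 0 ->
  f (c j) * E r (c i) + f (c i) * E r (c j) = 0.
Proof.
case: fE => f0 detE ij cH sumc detc.
have lin0 (k : 'I_n -> K) l : k l != 0 -> \sum_l k l *: c l != 0.
  by move=> kl; apply: contraNneq kl => kc0; rewrite (det_rows_eq0 detc kc0).
have natp (k : nat) : k.+1%:R != 0 :> K by rewrite pnatr_eq0.
(* As [t] is minus the sum of the [c l], being distinct from 0 and from [t] becomes the nonvanishing
   of a combination of the basis [c]; below, the coefficient singled out is always 1 or 2. *)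
have tE x : (x == t) = (\sum_l c l + x == 0) by rewrite sumc addrC subr_eq0.
have ci l : idx (c l).
  rewrite /idx cH tE -(sum_delta c l) andTb; apply/andP; split.
    by apply: (@lin0 (fun q => (q == l)%:R) l); rewrite eqxx oner_neq0.
  rewrite -big_split /=.
  under eq_bigr => q _ do rewrite -{1}[c q]scale1r -scalerDl.
  by apply: (@lin0 (fun q => 1 + (q == l)%:R) l); rewrite eqxx (natp 1%N).
have vi : idx (c i + c j).
  rewrite /idx rpredD // tE andTb.
  rewrite -(sum_delta c i) -(sum_delta c j) -!big_split /=.
  apply/andP; split; under eq_bigr => q _ do rewrite -scalerDl.
    apply: (@lin0 (fun q => (q == i)%:R + (q == j)%:R) i).
    by rewrite eqxx (negbTE ij) addr0 oner_neq0.
  under eq_bigr => q _ do rewrite -{1}[c q]scale1r -scalerDl.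
  apply: (@lin0 (fun q => 1 + ((q == i)%:R + (q == j)%:R)) i).
  by rewrite eqxx (negbTE ij) addr0 (natp 1%N).
pose v := c i + c j.
have repl l : \det (\matrix_(p, q) (if q == l then E p v
      else (\matrix_(p, q) E p (c q)) p q))
    = (\det (rows c) *+ (l == i) + \det (rows c) *+ (l == j))
      *: f (v - c l).
  rewrite -!det_rows_replace -det_rows_replaceD.
  have := detE (replace c l v) (idx_replace l ci vi).
  have -> : \sum_q replace c l v q + t = v - c l.
    by rewrite sum_replace sumc addrAC [- t - _ + t]addrAC addNr sub0r addrC.
  move=> <-.
  congr (\det _); apply/matrixP => p q; rewrite !mxE /replace.
  by case: eqP.
have := cramer_expansion (\matrix_(p, q) E p (c q)) (E^~ v) r.
rewrite detE // sumc addNr f0 scaler0 mul0r.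
under eq_bigr => l _ do rewrite repl mxE.
rewrite (bigD1 i) //= (bigD1 j) 1?eq_sym //= big1 => [|l]; last first.
  by case/andP=> /negbTE-> /negbTE->; rewrite addr0 scale0r mul0r.
rewrite !eqxx [j == i]eq_sym (negbTE ij) /v addr0 add0r addrK.
rewrite addrAC subrr add0r addr0 -!scalerAl -scalerDr => /esym/eqP.
by rewrite scaler_eq0 (negbTE detc) => /eqP.
Qed.

(** Complete [a], [b], [t] to a basis and exchange [t] for the vector that makes the total [- t].
    Then [t] is still in the span, and [anti_basis] applies to the first two vectors. *)
Lemma anti a b r : a \in H -> b \in H -> free [:: a; b; t] ->
  f b * E r a + f a * E r b = 0.
Proof.
move=> aH bH fr; have [Y YH bY] := free_extend spH fr.
pose C := [:: a, b, - (t + (a + b + \sum_(y <- Y) y)) & Y].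
have szC : size C = n.
  have := size_basis (X := in_tuple ([:: a; b; t] ++ Y)) bY.
  by rewrite dimvf /dim /= mul1n => /esym.
have sumC : \sum_(y <- C) y = - t.
  by rewrite !big_cons addrA addrCA opprD subrK.
have CH v : v \in C -> v \in H.
  rewrite !inE => /or4P[/eqP->|/eqP->|/eqP->|/YH//] //.
  by rewrite rpredN !rpredD // big_seq rpred_sum.
pose i : 'I_n := ord0; pose j : 'I_n := lift ord0 (Ordinal (ltnW m_gt1)).
apply: (@anti_basis (fun l => nth 0 C l) i j) => //.
- by move=> l; apply: CH; rewrite mem_nth // szC.
- by rewrite sum_nth_ord.
apply: det_rows_neq0; rewrite map_nth_enum_ord // -(span_basis bY).
apply/span_subvP => v vX.
have memC u : u \in C -> u \in <<C>>%VS by apply: memv_span.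
have [->|nvt] := eqVneq v t; last first.
  by apply: memC; move: vX; rewrite !inE (negbTE nvt) => /or4P[->|->||->] //; rewrite ?orbT.
rewrite -[t]opprK -sumC rpredN big_seq rpred_sum // => x; exact: memC.
Qed.

End System.

Lemma small_span (X : seq 'rV[K]_n) : (size X < n)%N -> ~~ (fullv <= <<X>>)%VS.
Proof.
apply: contraL => /dimvS; rewrite dimvf /dim /= mul1n -leqNgt => le.
exact: leq_trans le (dim_span X).
Qed.

Lemma idx_notin (U : {vspace 'rV[K]_n}) v :
  t \in U -> v \in H -> v \notin U -> idx v.
Proof.
move=> tU vH vU; rewrite /idx vH /=.
by apply/andP; split; apply: contraNneq vU => ->; rewrite ?mem0v.
Qed.

(* Every [f b] is, up to a nonzero scalar, a determinant in which all the
   arguments avoid a given proper subspace containing [t]. *)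
Lemma jacobian_avoid (B : comAlgType K) (f : 'rV[K]_n -> B) E
    (U : {vspace 'rV[K]_n}) b (P : B -> Prop) :
  jacobian_system f E -> ~~ (fullv <= U)%VS -> t \in U -> idx b ->
  (forall (d : K) (w : B), d != 0 -> P (d *: w) -> P w) ->
  (forall c, (forall i, c i \in H) -> (forall i, c i \notin U) ->
     (forall i, idx (c i)) -> \sum_i c i = b - t ->
     P (\det (\matrix_(p, q) E p (c q)))) ->
  P (f b).
Proof.
move=> [_ detE] nfull tU /and3P[bH b0 bt] PZ Pdet.
have m_gt0 : (0 < m)%N by apply: ltnW.
have btH : b - t \in H by rewrite rpredB.
have bt0 : b - t != 0 by rewrite subr_eq0.
have [c [cH cU sumc detc]] := exists_basis_sum m_gt0 spH nfull btH bt0.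
have ci i : idx (c i) by apply: (idx_notin tU).
by apply: (PZ _ _ detc); have := Pdet c cH cU ci sumc; rewrite detE // sumc subrK.
Qed.

Lemma mul_scale_eq0 (B : comAlgType K) (u w : B) (d : K) :
  d != 0 -> u * (d *: w) = 0 -> u * w = 0.
Proof.
by move=> d0 /eqP; rewrite -scalerAr scaler_eq0 (negbTE d0) => /eqP.
Qed.

Lemma span2_notin a : a \notin <<[:: t]>>%VS -> free [:: a; t].
Proof. by move=> at_; rewrite !free_cons at_ nil_free span_nil memv0 t_neq0. Qed.

Lemma t_span1 : t \in <<[:: t]>>%VS.
Proof. by rewrite memv_span ?mem_head. Qed.

Lemma t_span2 v : t \in <<[:: v; t]>>%VS.
Proof. by rewrite memv_span // !inE eqxx orbT. Qed.

(** * Systems with projections among the rows: W (one copy of [A]) and SW (one copy for each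
    colour) *)

Section Rows.
Variables (B : comAlgType K) (J : Type).
Variables (f : J -> 'rV[K]_n -> B) (E : J -> 'I_n -> 'rV[K]_n -> B).
Hypotheses (fE : forall k, jacobian_system (f k) (E k))
  (fJ : forall j k, exists r, E k r = f j).

(** When the row [E j r] is [f j] itself, [anti] reads [2 f_a f_b = 0]. *)
Lemma rows_free_eq0 j a b : a \in H -> b \in H -> free [:: a; b; t] ->
  f j a * f j b = 0.
Proof.
move=> aH bH fr; have [r Er] := fJ j j; have := anti (fE j) r aH bH fr.
rewrite Er mulrC -mulr2n -scaler_nat => /eqP.
by rewrite scaler_eq0 pnatr_eq0 /= => /eqP.
Qed.

(** Write [f k b] as a determinant with arguments outside [U]: its row equal to [f j] is annihilated
    by [f j a]. *)
Lemma rows_avoid_eq0 (U : {vspace 'rV[K]_n}) j k a b :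
  ~~ (fullv <= U)%VS -> t \in U -> idx b ->
  (forall v, v \in H -> v \notin U -> idx v -> f j a * f j v = 0) ->
  f j a * f k b = 0.
Proof.
move=> nfull tU ib av0.
apply: (jacobian_avoid (P := fun w => f j a * w = 0) (fE k) nfull tU ib).
  by move=> d w; apply: mul_scale_eq0.
move=> c cH cU ci _; have [r Er] := fJ j k.
by apply: (det_mulr0_row (i := r)) => q; rewrite mxE Er av0.
Qed.

(** Two passes of avoidance: if one index [x] is off the line of [t], avoid the span of [x] and [t],
    which is proper as [n >= 3]; if [a] is on the line, avoid the line and use the first pass. *)
Lemma rows_mul_eq0 j k a b : idx a -> idx b -> f j a * f k b = 0.
Proof.
have notin_eq0 i l x y : idx x -> x \notin <<[:: t]>>%VS -> idx y -> f i x * f l y = 0.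
  move=> ix xt iy; apply: (rows_avoid_eq0 (U := <<[:: x; t]>>)) => //.
  - exact: small_span.
  - exact: t_span2.
  move=> v vH vU _; rewrite mulrC rows_free_eq0 //; first by case/and3P: ix.
  by rewrite free_cons vU span2_notin.
move=> ia ib; have [at_|at_] := boolP (a \in <<[:: t]>>%VS); last exact: notin_eq0.
apply: (rows_avoid_eq0 (U := <<[:: t]>>)) => //.
- by apply: small_span; rewrite ltnS ltnW.
- exact: t_span1.
by move=> v vH vU iv; rewrite mulrC notin_eq0.
Qed.

End Rows.

(** * Systems whose rows are all derivations: S *)

Section Columns.
Variables (B : comAlgType K) (f : 'rV[K]_n -> B) (E : 'I_n -> 'rV[K]_n -> B).
Hypothesis fE : jacobian_system f E.
Hypothesis free_eq0 :
  forall a b, a \in H -> b \in H -> free [:: a; b; t] -> f a * f b = 0.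
(** The Leibniz rule for the [r]-th derivation, applied to [f a * f b = 0]. *)
Hypothesis swap :
  forall r a b, f a * f b = 0 -> f a * E r b = - f b * E r a.

(* Exchanging [a] with an argument [c i] of the determinant of [f x] gives
   [f a * f x = - d * f (c i) * f (a + x - c i)] for a scalar [d]. *)
Lemma columns_line_eq0 a x :
  a \in H -> a \notin <<[:: t]>>%VS -> idx x -> x \in <<[:: t]>>%VS ->
  f a * f x = 0.
Proof.
move=> aH at_ ix xt.
apply: (jacobian_avoid (P := fun w => f a * w = 0) (U := <<[:: a; t]>>) fE) => //.
- exact: small_span.
- exact: t_span2.
- by move=> d w; apply: mul_scale_eq0.
move=> c cH cU ci sumc; set i := ord0 : 'I_n.
have fr : free [:: c i; a; t] by rewrite free_cons cU span2_notin.
have ac0 : f a * f (c i) = 0 by rewrite mulrC free_eq0.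
rewrite (det_eqM_col (i := i) (y := - f (c i))
  (N := \matrix_(p, q) E p (replace c i a q))); first last.
- by move=> p q qi; rewrite !mxE /replace (negbTE qi).
- by move=> p; rewrite !mxE /replace eqxx swap.
have ia : idx a by apply: idx_notin at_ => //; exact: t_span1.
case: fE => _ ->; last exact: idx_replace.
rewrite sum_replace sumc -scalerAr mulNr free_eq0 ?oppr0 ?scaler0 //.
  by rewrite !rpredD ?rpredN //; case/and3P: ix.
have fr' : free [:: a; c i; t].
  by rewrite (@perm_free _ _ _ [:: c i; a; t]) // (perm_catCA [:: a] [:: c i]).
rewrite (@perm_free _ _ _ [:: x - t - c i + a + t; c i; t]); last first.
  by rewrite (perm_catCA [:: c i] [:: _]).
move: fr'; rewrite !(free_cons _ (_ :: _)) => /andP[aS ->]; rewrite andbT.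
(* As [x] is on the line of [t], the new index is congruent to [a] modulo the span of [c i] and
   [t]. *)
apply: contra aS => vS.
have tS : t \in <<[:: c i; t]>>%VS by exact: t_span2.
have cS : c i \in <<[:: c i; t]>>%VS by rewrite memv_span ?mem_head.
have xS : x \in <<[:: c i; t]>>%VS.
  by apply: subvP xt; apply: sub_span => v; rewrite !inE => ->; rewrite orbT.
by move: vS; rewrite rpredDr // rpredDl // !rpredB.
Qed.

Lemma columns_notin_eq0 x y :
  idx x -> y \in H -> y \notin <<[:: x; t]>>%VS -> f x * f y = 0.
Proof.
move=> ix yH yU; have [xt|xt] := boolP (x \in <<[:: t]>>%VS).
  rewrite mulrC columns_line_eq0 //; apply: contra yU; apply: subvP.
  by apply: sub_span => v; rewrite !inE => ->; rewrite orbT.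
rewrite mulrC free_eq0 //; first by case/and3P: ix.
by rewrite free_cons yU span2_notin.
Qed.

(** If [y] is outside the span of [x] and [t], already [f x * f y = 0]. Otherwise expand [f z] with
    arguments [c i] outside that span: [swap] turns [f x * f y * E p (c i)] into
    [- f (c i) * f y * E p x], and [f (c i) * f y = 0], so a column is annihilated. *)
Lemma columns_mul3_eq0 x y z : idx x -> idx y -> idx z -> f x * f y * f z = 0.
Proof.
move=> ix iy iz; have [yU|yU] := boolP (y \in <<[:: x; t]>>%VS); last first.
  by rewrite columns_notin_eq0 ?mul0r //; case/and3P: iy.
apply: (jacobian_avoid (P := fun w => f x * f y * w = 0) (U := <<[:: x; t]>>) fE) => //.
- exact: small_span.
- exact: t_span2.
- by move=> d w; apply: mul_scale_eq0.
move=> c cH cU ci _; apply: (det_mulr0_col (i := ord0)) => p; rewrite mxE.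
rewrite mulrAC swap; last by rewrite columns_notin_eq0.
rewrite mulrAC mulNr [f _ * f y]mulrC columns_notin_eq0 ?oppr0 ?mul0r //.
apply: contra (cU ord0); apply: subvP; apply/span_subvP => v.
by rewrite !inE => /orP[] /eqP-> //; exact: t_span2.
Qed.

End Columns.
End JacobianSystem.

(** * The unitization of a possibly nonunital commutative algebra *)

Section Unitization.
Variables (K : fieldType) (A : comAlgebra K).
Local Notation "f ** g" := (ca_mul f g) (at level 40, left associativity).

(* [A] need not have a unit; in the unitization [alg_det] becomes [\det]. *)
Definition unitization : Type := (K^o * A)%type.
HB.instance Definition _ := GRing.Lmodule.on unitization.

Lemma ca_mulDr (f g h : A) : f ** (g + h) = f ** g + f ** h.
Proof. by rewrite !(ca_mulC f) ca_mulDl. Qed.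

Lemma ca_scalerAr c (f g : A) : c *: (f ** g) = f ** (c *: g).
Proof. by rewrite ca_mulC ca_scalerAl ca_mulC. Qed.

Lemma ca_mul0r (f : A) : 0 ** f = 0.
Proof. by rewrite -[X in X ** f](scale0r (0 : A)) -ca_scalerAl scale0r. Qed.

Definition unit_mul (x y : unitization) : unitization :=
  (x.1 * y.1, x.1 *: y.2 + y.1 *: x.2 + x.2 ** y.2).

Lemma unit_mulA : associative unit_mul.
Proof.
move=> x y z; congr pair => /=; first by rewrite mulrA.
rewrite !scalerDr !scalerA !ca_mulDl !ca_mulDr -!ca_scalerAl -!ca_scalerAr.
rewrite !ca_mulA (mulrC z.1 x.1) (mulrC z.1 y.1) !addrA.
by rewrite [LHS](ACl (1*2*4*6*3*5*7)).
Qed.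

Lemma unit_mulC : commutative unit_mul.
Proof.
move=> x y; congr pair => /=; first by rewrite mulrC.
by rewrite ca_mulC [_ *: y.2 + _]addrC.
Qed.

Lemma unit_mul1 : left_id (1, 0) unit_mul.
Proof.
move=> [x u]; congr pair => /=; first by rewrite mul1r.
by rewrite scale1r scaler0 ca_mul0r !addr0.
Qed.

Lemma unit_mulDl : left_distributive unit_mul +%R.
Proof.
move=> x y z; congr pair => /=; first by rewrite mulrDl.
by rewrite ca_mulDl scalerDl scalerDr [RHS]addrACA [X in _ = X + _]addrACA.
Qed.

Lemma unit_oner_neq0 : (1, 0) != 0 :> unitization.
Proof. by apply/eqP => -[] /eqP; rewrite oner_eq0. Qed.

HB.instance Definition _ := GRing.Zmodule_isComNzRing.Build unitization
  unit_mulA unit_mulC unit_mul1 unit_mulDl unit_oner_neq0.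

Lemma unit_scalerAl (c : K) (x y : unitization) : c *: (x * y) = (c *: x) * y.
Proof.
congr pair => /=; first by rewrite -mulrA.
by rewrite !scalerDr !scalerA ca_scalerAl (mulrC y.1).
Qed.

HB.instance Definition _ :=
  GRing.Lmodule_isLalgebra.Build K unitization unit_scalerAl.
HB.instance Definition _ := GRing.Lalgebra_isComAlgebra.Build K unitization.

Definition embed (f : A) : unitization := (0, f).

Lemma embed_is_linear : linear embed.
Proof. by move=> c f g; congr pair => //=; rewrite scaler0 addr0. Qed.

HB.instance Definition _ := GRing.isLinear.Build K A unitization *:%R embed embed_is_linear.

Lemma embed_inj : injective embed. Proof. by move=> f g []. Qed.

Lemma embedM f g : embed (f ** g) = embed f * embed g.
Proof. by congr pair => /=; rewrite ?mul0r // !scale0r !add0r. Qed.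

(** For [k = 0] the two sides would be 0 and 1. *)
Lemma embed_fam_prod k (f : 'I_k -> A) : (0 < k)%N ->
  embed (fam_prod f) = \prod_i embed (f i).
Proof.
move=> k_gt0; have foldlE (s : seq A) f0 :
    embed (foldl (@ca_mul K A) f0 s) = embed f0 * \prod_(x <- s) embed x.
  elim: s f0 => [|g s IHs] f0 /=; first by rewrite big_nil mulr1.
  by rewrite IHs big_cons embedM mulrA.
rewrite /fam_prod -big_enum -(big_map f xpredT embed).
case: (map f _) (size_map f (enum 'I_k)) => [|g s] /=.
  by rewrite size_enum_ord => k0; rewrite -k0 in k_gt0.
by move=> _; rewrite foldlE big_cons.
Qed.

Lemma embed_alg_det k (M : 'I_k.+1 -> 'I_k.+1 -> A) :
  embed (alg_det M) = \det (\matrix_(i, j) embed (M i j)).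
Proof.
rewrite /alg_det linear_sum; apply: eq_bigr => s _.
rewrite linearZ /= embed_fam_prod // scaler_sign mulr_sign.
by under [in RHS]eq_bigr => i _ do rewrite mxE.
Qed.

End Unitization.

(** * Alternating multiadditive maps on coloured tuples *)

Section MultiadditiveAlternating.
Variables (K : fieldType) (A : comAlgebra K) (m : nat) (V : zmodType).
Local Notation L := (SW_space A m).
Variable G : ('I_m.+1 -> L) -> V.
Hypothesis GD : forall i x y z,
  G (replace x i (y + z)) = G (replace x i y) + G (replace x i z).
Hypothesis Galt : forall x i j, i != j -> x i = x j -> G x = 0.

Lemma replaceC (T : Type) (x : 'I_m.+1 -> T) i j u v : i != j ->
  replace (replace x i u) j v = replace (replace x j v) i u.
Proof.
move=> ij; apply/funext => q; rewrite /replace.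
by case: (eqVneq q j) => // ->; rewrite eq_sym (negbTE ij).
Qed.

Lemma replace_id (T : Type) (x : 'I_m.+1 -> T) i : replace x i (x i) = x.
Proof. by apply/funext => q; rewrite /replace; case: eqP => // ->. Qed.

Lemma alternating_tperm x i j : i != j -> G (x \o tperm i j) = - G x.
Proof.
move=> ij; pose y u v := replace (replace x i u) j v.
have yDr u v w : G (y u (v + w)) = G (y u v) + G (y u w) by apply: GD.
have yDl u v w : G (y (u + v) w) = G (y u w) + G (y v w).
  by rewrite /y !(replaceC _ _ _ ij) GD.
have y0 u : G (y u u) = 0.
  by apply: (Galt ij); rewrite /y /replace !eqxx (negbTE ij).
have := y0 (x i + x j); rewrite yDl !yDr !y0 add0r addr0 addrC => /eqP.
rewrite addr_eq0 /y !replace_id => /eqP <-; congr G; apply/funext => q.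
by rewrite /replace /=; case: tpermP => [->|->|/eqP/negbTE-> /eqP/negbTE->] //;
  rewrite ?eqxx ?(negbTE ij).
Qed.

Lemma alternating_perm_eq0 x (s : 'S_m.+1) : G x = 0 -> G (x \o s) = 0.
Proof.
move=> x0; have [ts -> dts] := prod_tpermP s.
elim: ts dts => [_|[i j] ts IHts /= /andP[ij dts]].
  by rewrite big_nil (_ : x \o _ = x) //; apply/funext => q; rewrite /= perm1.
rewrite big_cons /= -oppr0 -(IHts dts) -(alternating_tperm _ ij); congr G.
by apply/funext => q; rewrite /= permM.
Qed.

Lemma multiadditive0 x i : G (replace x i 0) = 0.
Proof. by apply: (addrI (G (replace x i 0))); rewrite -GD !addr0. Qed.

Lemma SW_decomp (u : L) : u = \sum_k colored k (u k).
Proof.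
apply/ffunP => k; rewrite sum_ffunE (bigD1 k) //= ffunE eqxx big1 ?addr0 //.
by move=> l lk; rewrite ffunE eq_sym (negbTE lk).
Qed.

Lemma colored_eq0 :
  (forall (c : 'I_m.+1 -> 'I_m) f, G (fun p => colored (c p) (f p)) = 0) ->
  forall x, G x = 0.
Proof.
move=> Gc0 x.
(* Homogeneity is known from position [k] on; each step splits one more argument into its
   colours. *)
have main k y : (k <= m.+1)%N ->
    (forall p : 'I_m.+1, (k <= p)%N -> exists c f, y p = colored c f) -> G y = 0.
  elim: k y => [|k IHk] y lek yE.
    have [c cE] := fin_all_exists (fun p => yE p (leq0n p)).
    have [f fE] := fin_all_exists cE.
    by rewrite (_ : y = fun p => colored (c p) (f p)) //; apply/funext.
  pose i := Ordinal lek; rewrite -(replace_id y i) [y i]SW_decomp.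
  rewrite (big_morph _ (GD i y) (multiadditive0 y i)) big1 // => l _.
  apply: IHk => [|p kp]; first exact: ltnW.
  rewrite /replace; case: eqVneq => [_|pi]; first by exists l, (y i l).
  by apply: yE; rewrite ltn_neqAle kp andbT eq_sym.
by apply: (main m.+1) => // p; rewrite leqNgt ltn_ord.
Qed.

(* A map from the [m+1] positions onto the [m] colors takes exactly one color
   twice: a section of it misses one position [p0], and reordering the
   positions along the section gives the standard form. *)
Lemma standard_eq0 :
  (forall (c : 'I_m.+1 -> 'I_m) (f : 'I_m.+1 -> A),
     (exists k, forall p, c p != k) -> G (fun p => colored (c p) (f p)) = 0) ->
  (forall (k : 'I_m) (f : 'I_m -> A) (h : A),
     G (insert (lift ord0 k) (colored k h) (fun i => colored i (f i))) = 0) ->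
  forall x, G x = 0.
Proof.
move=> missing standard; apply: colored_eq0 => c f.
have [/existsP[k /forallP ck]|] := boolP [exists k, forall p, c p != k].
  by apply: missing; exists k.
rewrite negb_exists => /forallP onto.
have /fin_all_exists[s sK] k : exists p, c p = k.
  have := onto k.
  by rewrite negb_forall => /existsP[p /negPn/eqP cp]; exists p.
have [p0 p0s] : exists p0, p0 \notin codom s.
  apply/existsP; rewrite -negb_forall; apply/negP => /forallP all_s.
  have : #|codom s| = m.+1.
    by rewrite -[RHS]card_ord; apply: eq_card => p; rewrite all_s.
  have := leq_image_card s 'I_m; rewrite card_ord => le_m eq_m.
  by rewrite eq_m ltnn in le_m.
pose tau := insert (lift ord0 (c p0)) p0 s.
have tau_inj : injective tau.
  have snp0 k : s k != p0 by apply: contraNneq p0s => <-; apply: codom_f.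
  move=> p q; rewrite /tau /insert.
  case: unliftP => [i ->|->]; case: unliftP => [j ->|->] //.
  - by move=> /(congr1 c); rewrite !sK => ->.
  - by move/eqP; rewrite (negbTE (snp0 i)).
  - by move/esym/eqP; rewrite (negbTE (snp0 j)).
set x := fun p => _.
have -> : x = (x \o tau) \o ((perm tau_inj)^-1)%g.
  by apply/funext => q /=; rewrite -(permE tau_inj) permKV.
apply: alternating_perm_eq0.
rewrite (_ : x \o tau = insert (lift ord0 (c p0)) (colored (c p0) (f p0))
  (fun i => colored i (f (s i)))) ?standard //.
apply/funext => q; rewrite /x /tau /insert /=.
by case: unlift => //= i; rewrite sK.
Qed.

End MultiadditiveAlternating.

(** * Each component of the SW bracket as a signed determinant *)

Section SWBracket.
Variables (K : fieldType) (A : comAlgebra K) (m : nat).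
Variables (D : A -> A) (br : ('I_m.+1 -> SW_space A m) -> SW_space A m).
Hypotheses (derD : derivation D) (br_SW : is_SW_bracket D br).
Local Notation L := (SW_space A m).

Lemma derivationD f g : D (f + g) = D f + D g.
Proof. by have [lin _] := derD; have := lin 1 f g; rewrite !scale1r. Qed.

Lemma derivation0 : D 0 = 0.
Proof. by apply: (addrI (D 0)); rewrite -derivationD !addr0. Qed.

(** The rows are the projections onto the colours in order, with the row of [D] placed right after
    projection [k]. This is also where a standard tuple has its second element of colour [k], so its
    matrix is bordered diagonal. *)
Definition SW_row (k : 'I_m) p (u : L) : unitization A :=
  embed (insert (lift ord0 k) (D (u k)) (fun i => u i) p).

Lemma SW_rowD k p u v : SW_row k p (u + v) = SW_row k p u + SW_row k p v.
Proof.
rewrite -linearD /SW_row /insert; congr embed.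
by case: unlift => [i|]; rewrite !ffunE ?derivationD.
Qed.

Lemma SW_row_D k u : SW_row k (lift ord0 k) u = embed (D (u k)).
Proof. by rewrite /SW_row /insert unlift_none. Qed.

Lemma SW_row_id k i u : SW_row k (lift (lift ord0 k) i) u = embed (u i).
Proof. by rewrite /SW_row /insert liftK. Qed.

Definition SW_mx k (x : 'I_m.+1 -> L) : 'M[unitization A]_m.+1 :=
  \matrix_(p, q) SW_row k p (x q).

Definition standard (k : 'I_m) (f : 'I_m -> A) (h : A) : 'I_m.+1 -> L :=
  insert (lift ord0 k) (colored k h) (fun i => colored i (f i)).

(** Colour [l] occurs only once in the tuple, so the projection to [l] and the row of [D] are both
    supported in that one column. *)
Lemma det_SW_mx_standard_neq k l f h : l != k ->
  \det (SW_mx l (standard k f h)) = 0.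
Proof.
move=> lk.
have off q : q != lift (lift ord0 k) l -> standard k f h q l = 0.
  rewrite /standard /insert; case: unliftP => [i ->|-> _].
    by rewrite (inj_eq lift_inj) ffunE eq_sym => /negbTE->.
  by rewrite ffunE (negbTE lk).
apply: (det0_rows (i := lift ord0 l) (j := lift (lift ord0 l) l)
  (q0 := lift (lift ord0 k) l)) => [|q qn|q qn]; first exact: neq_lift.
  by rewrite mxE SW_row_D off // derivation0 linear0.
by rewrite mxE SW_row_id off // linear0.
Qed.

Lemma det_SW_mx_standard k f h :
  \det (SW_mx k (standard k f h)) =
  (embed (f k) * embed (D h) - embed h * embed (D (f k)))
    * \prod_(i | i != k) embed (f i).
Proof.
set P := lift ord0 k.
have colP : standard k f h P = colored k h by rewrite /standard /insert unlift_none.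
have colE i : standard k f h (lift P i) = colored i (f i).
  by rewrite /standard /insert liftK.
have coloredE i l (g : A) : colored i g l = if i == l then g else 0.
  by rewrite ffunE eq_sym.
rewrite (det_bordered_diag (k := k) (h := embed h) (f := fun i => embed (f i))).
- by rewrite !mxE !SW_row_D colP colE !coloredE eqxx.
- move=> l lk; rewrite mxE SW_row_D colE coloredE (negbTE lk).
  by rewrite derivation0 linear0.
- move=> i; rewrite mxE SW_row_id colP coloredE eq_sym.
  by case: ifP; rewrite ?linear0.
- move=> i l; rewrite mxE SW_row_id colE coloredE eq_sym.
  by case: ifP => [/eqP->|_]; rewrite ?linear0.
Qed.

Lemma signrZ e (w : unitization A) : (-1) ^+ e *: w = (-1) ^+ e * w.
Proof. by rewrite -signr_odd scaler_sign -[in RHS]signr_odd mulr_sign. Qed.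

(** The difference of the two sides is alternating and multiadditive, so it suffices to treat tuples
    missing a colour and standard tuples. The determinant produces [f D(h) - h D(f)], the opposite
    of the factor in the bracket; hence [k + m] in place of [(k + m).+1]. *)
Lemma SW_bracketE x k :
  embed (br x k) = (-1) ^+ (k + m) * \det (SW_mx k x).
Proof.
have [br_lin br_alt br_miss br_std] := br_SW.
apply/eqP; rewrite -subr_eq0; apply/eqP; move: x.
apply: standard_eq0 => [i x y z|x i j ij xij|c f [l cl]|l f h].
- have := br_lin i x 1 y z; rewrite !scale1r => ->.
  rewrite (det_colD (M := SW_mx k (replace x i (y + z))) (i := i)
    (N := SW_mx k (replace x i y)) (P := SW_mx k (replace x i z))).
  + by rewrite ffunE linearD /= mulrDr opprD addrACA.
  + by move=> p; rewrite !mxE /replace eqxx SW_rowD.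
  + by move=> p q /negbTE qi; rewrite !mxE /replace qi.
  + by move=> p q /negbTE qi; rewrite !mxE /replace qi.
- rewrite (br_alt _ _ _ ij xij) ffunE linear0 -det_tr.
  rewrite (determinant_alternate ij) ?mulr0 ?subr0 // => p.
  by rewrite !mxE xij.
- rewrite br_miss; last by exists l.
  rewrite ffunE linear0 sub0r -[\det _]mul1r.
  rewrite (det_mulr0_row (i := lift (lift ord0 k) l)) ?mulr0 ?oppr0 // => q.
  by rewrite mxE SW_row_id ffunE eq_sym (negbTE (cl q)) linear0 mulr0.
- rewrite br_std -/(standard l f h).
  rewrite -[\det _]/(\det (SW_mx k (standard l f h))) ffunE ffunE.
  have [->|kl] := eqVneq k l; last first.
    by rewrite det_SW_mx_standard_neq // scaler0 linear0 mulr0 subrr.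
  have m_gt0 : (0 < m)%N by apply: leq_ltn_trans (ltn_ord l).
  rewrite linearZ /= embed_fam_prod // det_SW_mx_standard (bigD1 l) //= eqxx.
  rewrite linearB /= !embedM (eq_bigr (fun i => embed (f i))) => [|i /negbTE->] //.
  rewrite signrZ exprS mulN1r mulNr -opprD -mulrDr -mulrDl.
  by rewrite [embed h * _]mulrC addrA subrK subrr mul0r mulr0 oppr0.
Qed.

End SWBracket.

(** * Isomorphisms from P(H,t) and the contradiction in each of the three cases *)

Lemma malgU_scale (I : choiceType) (K : fieldType) (d : K) (a : I) :
  << d *g a >> = d *: << a >> :> {malg K[I]}.
Proof. by apply/malgP => b; rewrite mcoeffZ !mcoeffU mulr_natr. Qed.

Section Isomorphism.
Variables (K : numFieldType) (m : nat) (m_gt1 : (1 < m)%N).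
Local Notation n := m.+1.
Variables (H : zmodClosed 'rV[K]_n) (spH : spans H).
Variables (t : 'rV[K]_n) (tH : t \in H) (t_neq0 : t != 0).

Section Image.
Variables (L : lmodType K) (br : ('I_n -> L) -> L).
Variable phi : {linear P_space H t -> L}.
Hypothesis phi_bij : bijective phi.
Hypothesis phiE : forall x : 'I_n -> P_space H t,
  phi (P_bracket x) = br (fun i => phi (x i)).

Definition image_u v := phi (P_u H t v).

Lemma image_u0 : image_u 0 = 0.
Proof. by rewrite /image_u /P_u insubF ?linear0 // eqxx andbF. Qed.

Lemma image_u_bracket (c : 'I_n -> 'rV[K]_n) : (forall i, idx H t (c i)) ->
  br (fun i => image_u (c i)) = \det (rows c) *: image_u (\sum_i c i + t).
Proof.
move=> ci; pose a i : P_index H t := Sub (c i) (ci i).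
by have := congr1 phi (P_bracket_basis a); rewrite phiE linearZ.
Qed.

(** As [phi] is onto, the images of the basis vectors span [L]. *)
Lemma image_u_ind (Q : L -> Prop) : Q 0 ->
  (forall d v y, idx H t v -> Q y -> Q (d *: image_u v + y)) -> forall y, Q y.
Proof.
move=> Q0 QD y; have [psi _ psiK] := phi_bij; rewrite -[y]psiK.
rewrite [psi y]monalgE raddf_sum /=.
elim/big_rec: _ => // a z _ Qz.
have -> : << (psi y)@_a *g a >> = (psi y)@_a *: P_u H t (val a).
  by rewrite /P_u valK malgU_scale.
by rewrite linearZ; apply: QD => //; apply: valP.
Qed.

Lemma image_u_mul0 (B : comAlgType K) (e : L -> B) w : linear e ->
  (forall v, idx H t v -> e (image_u v) * w = 0) -> forall y, e y * w = 0.
Proof.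
move=> lin_e ew0; elim/image_u_ind => [|d v y iv IHy].
  by have := lin_e (- 1) 0 0; rewrite scaler0 addr0 scaleN1r addNr => ->; rewrite mul0r.
by rewrite lin_e mulrDl -scalerAl ew0 // IHy scaler0 addr0.
Qed.

End Image.

(** As [n >= 3], every term of the determinant has at least three factors. *)
Lemma det_mul3_eq0 (B : comPzRingType) (M : 'M[B]_n) :
  (forall i j i' j' i'' j'', M i j * M i' j' * M i'' j'' = 0) -> \det M = 0.
Proof.
case: m m_gt1 M => // -[|k] // _ M M0; rewrite /determinant big1 // => s _.
by rewrite !big_ord_recl 2![X in _ * X]mulrA M0 mul0r mulr0.
Qed.

Section Embedded.
Variables (A : comAlgebra K).

Lemma S_not_isomorphic (D : 'I_n -> A -> A) :
  (forall r, derivation (D r)) -> simple_nonabelian_nLie (S_bracket D) ->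
  ~ nLie_isomorphic (@P_bracket K n H t) (S_bracket D).
Proof.
move=> derD [_ [_ simpleS] [x0 brx0]] [phi phi_bij phiE].
pose f v := embed (image_u phi v).
pose E r v := embed (D r (image_u phi v)).
have SE x : embed (S_bracket D x) = \det (\matrix_(p, q) embed (D p (x q))).
  exact: embed_alg_det.
have fE : jacobian_system H t f E.
  split=> [|c ci]; first by rewrite /f image_u0 linear0.
  by have := SE (fun q => image_u phi (c q)); rewrite (image_u_bracket phiE ci) linearZ.
have DM r g h : embed (D r (ca_mul g h)) = embed (D r g) * embed h + embed g * embed (D r h).
  by have [_ ->] := derD r; rewrite linearD /= !embedM.
have D0 r : D r 0 = 0.
  by have [lin _] := derD r; have := lin (- 1) 0 0; rewrite scaler0 addr0 scaleN1r addNr.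
(* A common constant of the derivations gives a zero column in every bracket, so the constants form
   an ideal on which the bracket vanishes; simplicity and a nonzero bracket leave only 0. *)
have constE : [set g | forall r, D r g = 0] = [set 0].
  case: (simpleS [set g | forall r, D r g = 0]) => // [|full].
    split; first split=> [r|g h Dg Dh r|d g Dg r] //=.
    - have [lin _] := derD r; have := lin 1 g h; rewrite !scale1r => ->.
      by rewrite Dg Dh addr0.
    - have [lin _] := derD r; have := lin d g 0; rewrite !addr0 => ->.
      by rewrite Dg D0 scaler0 addr0.
    move=> x Dx; suff -> : S_bracket D x = 0 by [].
    apply: embed_inj; rewrite SE linear0 -[LHS]mul1r.
    by apply: (det_mulr0_col (i := ord0)) => p; rewrite mxE Dx linear0 mulr0.
  case: brx0; apply: embed_inj; rewrite SE linear0 -[LHS]mul1r.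
  apply: (det_mulr0_col (i := ord0)) => p; rewrite mxE.
  have : [set g | forall r, D r g = 0] (x0 ord0) by rewrite full.
  by move=> ->; rewrite linear0 mulr0.
have free_eq0 a b : a \in H -> b \in H -> free [:: a; b; t] -> f a * f b = 0.
  move=> aH bH fr; rewrite /f -embedM.
  suff : [set g | forall r, D r g = 0] (ca_mul (image_u phi a) (image_u phi b)).
    by rewrite constE => ->; rewrite linear0.
  (* By the Leibniz rule, [anti] says that [D r] kills the product. *)
  move=> r; apply: embed_inj; rewrite DM linear0 mulrC.
  exact: (anti m_gt1 spH tH fE r aH bH fr).
have swap r a b : f a * f b = 0 -> f a * E r b = - f b * E r a.
  rewrite mulNr /f -embedM => ab0; apply/eqP; rewrite -addr_eq0 addrC mulrC.
  by rewrite -DM (embed_inj (etrans ab0 (esym (linear0 _)))) D0 linear0.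
have span0 w := image_u_mul0 phi_bij (w := w) (embed_is_linear (A := A)).
have prod0 x y z : embed x * embed y * embed z = 0 :> unitization A.
  rewrite -mulrA; apply: (span0 _) => a ia; rewrite mulrCA; apply: (span0 _) => b ib.
  rewrite mulrA mulrC; apply: (span0 _) => c ic; rewrite mulrA.
  exact: (columns_mul3_eq0 m_gt1 spH tH t_neq0 fE free_eq0 swap).
apply: brx0; apply: embed_inj; rewrite SE linear0; apply: det_mul3_eq0 => *.
by rewrite !mxE prod0.
Qed.

Lemma W_not_isomorphic (D : 'I_m -> A -> A) :
  simple_nonabelian_nLie (W_bracket D) ->
  ~ nLie_isomorphic (@P_bracket K n H t) (W_bracket D).
Proof.
move=> [_ _ [x0 brx0]] [phi phi_bij phiE].
pose f (_ : unit) v := embed (image_u phi v).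
pose E (_ : unit) p v :=
  embed (insert ord0 (image_u phi v) (fun r => D r (image_u phi v)) p).
have WE x : embed (W_bracket D x) =
    \det (\matrix_(p, q) embed (insert ord0 (x q) (fun r => D r (x q)) p)).
  exact: embed_alg_det.
have fE k : jacobian_system H t (f k) (E k).
  split=> [|c ci]; first by rewrite /f image_u0 linear0.
  by have := WE (fun q => image_u phi (c q)); rewrite (image_u_bracket phiE ci) linearZ.
have fJ j k : exists r, E k r = f j.
  by exists ord0; apply/funext => v; rewrite /E /insert unlift_none.
have span0 w := image_u_mul0 phi_bij (w := w) (embed_is_linear (A := A)).
have prod0 x y : embed x * embed y = 0 :> unitization A.
  apply: (span0 _) => a ia; rewrite mulrC; apply: (span0 _) => b ib.
  exact: (rows_mul_eq0 m_gt1 spH tH t_neq0 fE fJ tt tt).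
apply: brx0; apply: embed_inj; rewrite WE linear0; apply: det_mul3_eq0 => *.
by rewrite !mxE prod0 mul0r.
Qed.

Lemma SW_not_isomorphic (D : A -> A)
    (br : ('I_n -> SW_space A m) -> SW_space A m) :
  derivation D -> is_SW_bracket D br -> simple_nonabelian_nLie br ->
  ~ nLie_isomorphic (@P_bracket K n H t) br.
Proof.
move=> derD br_SW [_ _ [x0 brx0]] [phi phi_bij phiE].
have brE := SW_bracketE derD br_SW.
pose f (k : 'I_m) v := embed (image_u phi v k).
(* The sign of [SW_bracketE] is absorbed in the row of [D]. *)
pose s (k : 'I_m) p : unitization A := if p == lift ord0 k then (-1) ^+ (k + m) else 1.
pose E (k : 'I_m) p v := s k p * SW_row D k p (image_u phi v).
have fE k : jacobian_system H t (f k) (E k).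
  split=> [|c ci]; first by rewrite /f image_u0 ffunE linear0.
  have := brE (fun q => image_u phi (c q)) k.
  rewrite (image_u_bracket phiE ci) ffunE linearZ => ->.
  rewrite -[LHS]mul1r -det_tr -[in RHS]det_tr.
  (* After transposition the signed row is a column. *)
  apply: (det_eqM_col (i := lift ord0 k)) => [q|q p /negbTE pn].
    by rewrite mul1r !mxE /E /s eqxx.
  by rewrite !mxE /E /s pn mul1r.
have fJ j k : exists r, E k r = f j.
  exists (lift (lift ord0 k) j); apply/funext => v.
  by rewrite /E /s eq_sym (negbTE (neq_lift _ _)) mul1r SW_row_id.
have span0 j w : (forall v, idx H t v -> f j v * w = 0) ->
    forall u : SW_space A m, embed (u j) * w = 0.
  by apply: (image_u_mul0 phi_bij) => d u v; rewrite !ffunE embed_is_linear.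
have prod0 (x y : A) : embed x * embed y = 0 :> unitization A.
  (* Any colour would do: each element of [A] is the [j]-th component of a coloured element. *)
  pose j : 'I_m := Ordinal (ltnW m_gt1).
  have coloredj (g : A) : colored j g j = g by rewrite ffunE eqxx.
  rewrite -(coloredj x) -(coloredj y).
  apply: (span0 _ _) => a ia; rewrite mulrC; apply: (span0 _ _) => b ib.
  exact: (rows_mul_eq0 m_gt1 spH tH t_neq0 fE fJ).
apply: brx0; apply/ffunP => k; apply: embed_inj; rewrite brE ffunE linear0.
rewrite det_mul3_eq0 ?mulr0 // => *.
by rewrite !mxE /SW_row prod0 mul0r.
Qed.

End Embedded.
End Isomorphism.

(* The arity is n = m.+1. *)
Theorem theorem1p1 (R : realType) (m : nat) (hn : (3 <= m.+1)%N)
    (H : zmodClosed 'rV[R[i]]_m.+1) (hH : spans H)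
    (t : 'rV[R[i]]_m.+1) (tH : t \in H) (t0 : t != 0) :
  [/\ forall (A : comAlgebra R[i]) (g : set (A -> A)) (D : 'I_m.+1 -> A -> A),
        lie_subalgebra_Der g -> basis_Der g D -> g_simple g ->
        simple_nonabelian_nLie (S_bracket D) ->
        ~ nLie_isomorphic (@P_bracket R[i] m.+1 H t) (S_bracket D),
      forall (A : comAlgebra R[i]) (g : set (A -> A)) (D : 'I_m -> A -> A),
        lie_subalgebra_Der g -> basis_Der g D -> g_simple g ->
        simple_nonabelian_nLie (W_bracket D) ->
        ~ nLie_isomorphic (@P_bracket R[i] m.+1 H t) (W_bracket D) &
      forall (A : comAlgebra R[i]) (D : A -> A)
          (br : ('I_m.+1 -> SW_space A m) -> SW_space A m),
        derivation D -> g_simple [set D] -> is_SW_bracket D br ->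
        simple_nonabelian_nLie br ->
        ~ nLie_isomorphic (@P_bracket R[i] m.+1 H t) br].
Proof.
have m_gt1 : (1 < m)%N := hn.
split=> [A g D lieg [gD _ _] _|A g D _ _ _|A D br derD _ br_SW].
- apply: (S_not_isomorphic m_gt1 hH tH t0) => r.
  by have [der_g _ _ _] := lieg; apply: der_g.
- exact: (W_not_isomorphic m_gt1 hH tH t0).
- exact: (SW_not_isomorphic m_gt1 hH tH t0 derD br_SW).
Qed.
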